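(* Let $n\ge1$ and fix $k\in\{1,\dots,n\}$. There is a constant $C>0$ (independent of $q$ and of the functions) such that for every odd prime power $q$ and all nonnegative $f_1,\dots,f_{2n}:\mathbb{F}_q^{2n}\to\mathbb{R}$, \[ \frac{1}{q^{2n+1}}\sum_{(x,t)\in\mathbb{F}_q^{2n}\times\mathbb{F}_q}\prod_{j=1}^{2n}f_j(\pi_j(x,t))\le C\,\|f_k\|_{L^{\frac{2n+1}{2}}}\|f_{n+k}\|_{L^{\frac{2n+1}{2}}}\prod_{\substack{j=1\\ j\neq k}}^{n}\Big(\|f_j\|_{L^{2n+1}}\|f_{n+j}\|_{L^{2n+1}}\Big), \] where all norms are $L^r(\mathbb{F}_q^{2n},dx)$ norms.
   Context: The Heisenberg group $\mathbb{H}^n(\mathbb{F}_q)$ is $\mathbb{F}_q^{2n}\times\mathbb{F}_q$ with product $(x,t)\cdot(x',t')=\big(x+x',\,t+t'+\tfrac12\sum_{j=1}^n(x_jx'_{n+j}-x_{n+j}x'_j)\big)$. For $x\in\mathbb{F}_q^{2n}$, $\widehat{x}_j\in\mathbb{F}_q^{2n-1}$ is $x$ with its $j$-th coordinate removed. The projections $\pi_j:\mathbb{H}^n(\mathbb{F}_q)\to\mathbb{F}_q^{2n}$ are, for $1\le j\le n$: $\pi_j(x,t)=(\widehat{x}_j,\,t+\tfrac12x_jx_{n+j})$ and $\pi_{n+j}(x,t)=(\widehat{x}_{n+j},\,t-\tfrac12x_jx_{n+j})$. Norms are normalized: $\|f\|_{L^r(\mathbb{F}_q^{2n},dx)}=(q^{-2n}\sum_{x\in\mathbb{F}_q^{2n}}|f(x)|^r)^{1/r}$.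 *)

(* Defs.v *)
From mathcomp Require Import all_boot all_order all_algebra.
From mathcomp Require Import all_classical all_reals all_analysis.

Set Implicit Arguments.
Unset Strict Implicit.
Unset Printing Implicit Defensive.

Import Order.TTheory GRing.Theory Num.Theory.

Local Open Scope ring_scope.

Lemma ord_predn_addn1 (m : nat) (j : 'I_m) : (m.-1 + 1)%N = m.
Proof. by rewrite addn1 prednK // (leq_ltn_trans _ (ltn_ord j)). Qed.

(* The vector (x^_j, s) of F^m: the j-th coordinate of x is removed and s is
   appended as last coordinate. *)
Definition drop_append (F : finFieldType) (m : nat) (j : 'I_m)
    (x : 'rV[F]_m) (s : F) : 'rV[F]_m :=
  castmx (erefl 1%N, ord_predn_addn1 j) (row_mx (col' j x) (const_mx s)).

(* The projections from the Heisenberg group, with underlying set F^(2n) x F.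
   Indices are 0-based; x_i and x_(n+i) are x 0 (lshift n i) and
   x 0 (rshift n i) for i : 'I_n. *)
Definition heis_proj (F : finFieldType) (n : nat) (j : 'I_(n + n))
    (p : 'rV[F]_(n + n) * F) : 'rV[F]_(n + n) :=
  let: (x, t) := p in
  drop_append j x
    match fintype.split j with
    | inl i => t + 2^-1 * x 0 (lshift n i) * x 0 (rshift n i)
    | inr i => t - 2^-1 * x 0 (lshift n i) * x 0 (rshift n i)
    end.

(* L^r norm for the normalized counting measure on F^m (0 < r < oo). *)
Definition Lr_norm (R : realType) (F : finFieldType) (m : nat) (r : R)
    (f : 'rV[F]_m -> R) : R :=
  ((#|F|%:R ^+ m)^-1 * \sum_(x : 'rV[F]_m) `|f x| `^ r) `^ r^-1.

(* Main.v *)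
(* Fix all coordinates of x except the k-th and (n+k)-th.  In the remaining three
   variables Hölder's inequality reduces matters to the case n = 1, which says that
   the X-ray transform h |-> sum_a h(a, s - ab) of the plane maps L^(3/2) to L^3.
   That bound is seen by expanding the cube of the transform into a sum over
   triples of points on a line: with u = w^(2/3), AM-GM bounds
   u(P) u(Q) u(R) by (w(P) w(Q) + w(P) w(R) + w(Q) w(R)) / 3, and two points with
   distinct first coordinates lie on at most one line.  After averaging over t the
   shifts +-x_j x_(n+j) / 2 disappear, so the j-th function no longer depends on
   x_j, and Finner's inequality in the other 2n - 2 coordinates gives the result. *)
Require Import Defs.
From mathcomp Require Import all_boot all_order all_algebra.
From mathcomp Require Import all_classical all_reals all_analysis.
From mathcomp Require Import ring lra.

Set Implicit Arguments.
Unset Strict Implicit.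
Unset Printing Implicit Defensive.

Import Order.TTheory GRing.Theory Num.Theory.

Local Open Scope ring_scope.

(** * Normalized averages over finite types *)

(** On an empty type the value is 0, because [0^-1 = 0]; hence the explicit point [x0] in
    [avg_cst]. *)
Definition avg (R : realType) (T : finType) (f : T -> R) : R :=
  #|T|%:R^-1 * \sum_x f x.

Lemma eq_avg (R : realType) (T : finType) (f g : T -> R) :
  f =1 g -> avg f = avg g.
Proof. by move=> fg; congr (_ * _); apply: eq_bigr => x _; apply: fg. Qed.

Lemma avg_ge0 (R : realType) (T : finType) (f : T -> R) :
  (forall x, 0 <= f x) -> 0 <= avg f.
Proof. by move=> f0; rewrite mulr_ge0 ?invr_ge0 ?ler0n ?sumr_ge0. Qed.

Lemma ler_avg (R : realType) (T : finType) (f g : T -> R) :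
  (forall x, f x <= g x) -> avg f <= avg g.
Proof. by move=> fg; rewrite ler_wpM2l ?invr_ge0 ?ler0n ?ler_sum. Qed.

Lemma avgZ (R : realType) (T : finType) (c : R) (f : T -> R) :
  avg (fun x => c * f x) = c * avg f.
Proof. by rewrite /avg -mulr_sumr mulrCA. Qed.

Lemma avg_cst (R : realType) (T : finType) (x0 : T) (c : R) :
  avg (fun _ : T => c) = c.
Proof.
rewrite /avg sumr_const -[c *+ _]mulr_natl mulKf // pnatr_eq0 -lt0n.
by apply/card_gt0P; exists x0.
Qed.

Lemma avg_pair (R : realType) (S T : finType) (f : S * T -> R) :
  avg f = avg (fun x => avg (fun y => f (x, y))).
Proof.
rewrite /avg -mulr_sumr card_prod natrM invfM mulrA; congr (_ * _).
by rewrite pair_big; apply: eq_bigr => -[].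
Qed.

Lemma exchange_avg (R : realType) (S T : finType) (f : S -> T -> R) :
  avg (fun x => avg (f x)) = avg (fun y => avg (f ^~ y)).
Proof. by rewrite /avg -!mulr_sumr exchange_big /= mulrCA. Qed.

Lemma reindex_avg (R : realType) (T : finType) (h : T -> T) (f : T -> R) :
  injective h -> avg (fun x => f (h x)) = avg f.
Proof. by move=> hI; congr (_ * _); rewrite [RHS](reindex_inj hI). Qed.

(** * Weighted AM-GM and Hölder's inequality *)

(** Raise [y <= expR (y - 1)] to the power [p]. This is the pointwise input of Pólya's proof of
    AM-GM. *)
Lemma powR_le_expR (R : realType) (p y : R) :
  0 < p -> 0 <= y -> y `^ p <= expR (p * (y - 1)).
Proof.
move=> p0; rewrite le0r => /predU1P[->|y0].
  by rewrite powR0 ?gt_eqF ?expR_ge0.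
rewrite mulrC expRM; apply: ge0_ler_powR;
  rewrite ?nnegrE ?expR_ge0 ?(ltW p0) ?(ltW y0) //.
by rewrite (le_trans _ (expR_ge1Dx _)) // addrC subrK.
Qed.

Lemma weighted_AMGM (R : realType) (J : finType) (P : pred J) (p y : J -> R) :
  (forall j, P j -> 0 < p j) -> (forall j, P j -> 0 <= y j) ->
  \sum_(j | P j) p j = 1 ->
  \prod_(j | P j) y j `^ p j <= \sum_(j | P j) p j * y j.
Proof.
move=> p0 y0 p1; set S := \sum_(j | P j) p j * y j.
have S0 : 0 <= S by apply: sumr_ge0 => j Pj; rewrite mulr_ge0 ?y0 // ltW ?p0.
(* If [S = 0], every [y j] vanishes, and [P] is inhabited since the weights sum to 1; so the product
   has a zero factor. *)
have [SE|Sn0] := eqVneq S 0.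
  have y_eq0 j : P j -> y j = 0.
    move=> Pj; have /eqP := psumr_eq0P
      (fun i Pi => mulr_ge0 (ltW (p0 i Pi)) (y0 i Pi)) SE Pj.
    by rewrite mulf_eq0 gt_eqF ?p0 //= => /eqP.
  have [j Pj|P0] := pickP P.
    by rewrite (bigD1 j) //= y_eq0 // powR0 ?gt_eqF ?p0 // mul0r.
  rewrite (big_pred0 _ _ _ _ P0) in p1.
  by case/eqP: (oner_neq0 R).
have Sgt0 : 0 < S by rewrite lt0r Sn0.
have yp_le j : P j -> 0 <= y j `^ p j <= expR (p j * (ln S + (y j / S - 1))).
  move=> Pj; rewrite powR_ge0 mulrDr expRD /=.
  rewrite -{1}[y j](divfK Sn0) powRM ?divr_ge0 ?y0 // mulrC ler_pM ?powR_ge0 //.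
    by rewrite /powR (negbTE Sn0).
  by rewrite powR_le_expR ?p0 ?divr_ge0 ?y0.
rewrite (le_trans (ler_prod _ yp_le)) // -expR_sum.
under eq_bigr do rewrite mulrDr.
rewrite big_split /= -mulr_suml p1 mul1r.
under eq_bigr do rewrite mulrBr mulr1 mulrA.
by rewrite sumrB -mulr_suml p1 divff // subrr addr0 lnK ?posrE.
Qed.

(** Divide each [f j] by its average and apply AM-GM at every point; the mean of the right-hand side
    is then the sum of the weights, which is 1. *)
Lemma holder_avg (R : realType) (T J : finType) (P : pred J) (p : J -> R)
    (f : J -> T -> R) :
  (forall j, P j -> 0 < p j) -> (forall j x, P j -> 0 <= f j x) ->
  \sum_(j | P j) p j = 1 ->
  avg (fun x => \prod_(j | P j) f j x `^ p j) <= \prod_(j | P j) avg (f j) `^ p j.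
Proof.
move=> p0 f0 p1.
have S0 j : P j -> 0 <= avg (f j) by move=> Pj; apply: avg_ge0 => x; apply: f0.
have [j /andP[Pj /eqP Sj0]|Sn0] := pickP (fun j => P j && (avg (f j) == 0)).
  suff -> : avg (fun x => \prod_(j | P j) f j x `^ p j) = 0.
    by apply: prodr_ge0 => i _; apply: powR_ge0.
  rewrite /avg big1 ?mulr0 // => x _; rewrite (bigD1 j) //=.
  suff -> : f j x = 0 by rewrite powR0 ?mul0r // gt_eqF ?p0.
  (* The average vanishes either because [T] is empty, which the point [x] rules out, or because the
     sum is 0. *)
  move/eqP: Sj0; rewrite mulf_eq0 invr_eq0 pnatr_eq0 => /orP[/eqP T0|/eqP Sj0].
    by have /card0_eq/(_ x) := T0.
  by apply: (psumr_eq0P _ Sj0) => // y _; apply: f0.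
have {}Sn0 j : P j -> avg (f j) != 0.
  by move=> Pj; have := Sn0 j; rewrite Pj /= => ->.
have le_f x : \prod_(j | P j) f j x `^ p j <= (\prod_(j | P j) avg (f j) `^ p j) *
    \sum_(j | P j) p j * (f j x / avg (f j)).
  have -> : \prod_(j | P j) f j x `^ p j = (\prod_(j | P j) avg (f j) `^ p j) *
      \prod_(j | P j) (f j x / avg (f j)) `^ p j.
    rewrite -big_split; apply: eq_bigr => j Pj /=.
    by rewrite -powRM ?divr_ge0 ?f0 ?S0 // mulrCA divff ?mulr1 ?Sn0.
  rewrite ler_wpM2l ?prodr_ge0 // => [j _|]; first exact: powR_ge0.
  by rewrite weighted_AMGM // => j Pj; rewrite divr_ge0 ?f0 ?S0.
apply: (le_trans (ler_avg le_f)); rewrite avgZ ler_piMr //.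
  by apply: prodr_ge0 => j _; apply: powR_ge0.
rewrite {1}/avg exchange_big /= mulr_sumr -[leRHS]p1; apply: ler_sum => j Pj.
have -> : #|T|%:R^-1 * \sum_x p j * (f j x / avg (f j)) =
    p j * (avg (f j) / avg (f j)).
  by rewrite -mulr_sumr -mulr_suml mulrCA [in RHS]/avg !mulrA.
by rewrite divff ?mulr1 ?Sn0.
Qed.

(** * The X-ray transform in the plane and the case n = 1 *)

(** Expanding the cube, triples of distinct points contribute at most [#|T|%:R * D] by AM-GM, and
    triples with a coincidence at most [3 * (P1 * P2)]. This error is either absorbed by half of the
    left-hand side, which gives the constant 2, or dominates it, which gives 36. *)
Lemma cube_sum_le (R : realFieldType) (T : finType) (v : T -> R) :
  (forall a, 0 <= v a) ->
  (\sum_a v a ^+ 2) ^+ 3 <=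
    2 * #|T|%:R * (\sum_a \sum_(b | b != a) v a ^+ 3 * v b ^+ 3) +
    36 * \sum_a v a ^+ 6.
Proof.
move=> v0; set P1 := \sum_a v a ^+ 2; set D := \sum_a _; set P3 := \sum_a v a ^+ 6.
pose P2 := \sum_a v a ^+ 4.
have P10 : 0 <= P1 by apply: sumr_ge0 => a _; rewrite exprn_ge0.
have P30 : 0 <= P3 by apply: sumr_ge0 => a _; rewrite exprn_ge0.
have P20 : 0 <= P2 by apply: sumr_ge0 => a _; rewrite exprn_ge0.
(* Cauchy-Schwarz for the vectors [v a] and [v a ^+ 3]. *)
have CS : P2 ^+ 2 <= P1 * P3.
  have [P1E|P1n0] := eqVneq P1 0.
    suff -> : P2 = 0 by rewrite P1E mul0r expr0n.
    rewrite /P2 big1 // => a _.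
    have /eqP := psumr_eq0P (fun a _ => exprn_ge0 2 (v0 a)) P1E (i:=a) isT.
    by rewrite expf_eq0 /= => /eqP ->; rewrite expr0n.
  have P1gt0 : 0 < P1 by rewrite lt0r P1n0.
  have : 0 <= \sum_a (P1 * v a ^+ 3 - P2 * v a) ^+ 2.
    by apply: sumr_ge0 => a _; rewrite sqr_ge0.
  have -> : \sum_a (P1 * v a ^+ 3 - P2 * v a) ^+ 2 = P1 * (P1 * P3 - P2 ^+ 2).
    transitivity (\sum_a
      (P1 ^+ 2 * v a ^+ 6 - 2 * P1 * P2 * v a ^+ 4 + P2 ^+ 2 * v a ^+ 2)).
      by apply: eq_bigr => a _; ring.
    by rewrite big_split sumrB -!mulr_sumr -/P1 -/P2 -/P3 /=; ring.
  by rewrite pmulr_rge0 // subr_ge0.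
have expand : P1 ^+ 3 <= #|T|%:R * D + 3 * (P1 * P2).
  pose t a b c := v a ^+ 2 * v b ^+ 2 * v c ^+ 2.
  pose d (a b : T) : R := (b != a)%:R * (v a ^+ 3 * v b ^+ 3).
  pose e (a b : T) : R := (b == a)%:R.
  have cubeE : P1 ^+ 3 = \sum_a \sum_b \sum_c t a b c.
    rewrite !exprS expr0 mulr1 {1}/P1 mulr_suml; apply: eq_bigr => a _.
    rewrite {1}/P1 mulr_suml mulr_sumr; apply: eq_bigr => b _.
    by rewrite /P1 !mulr_sumr; apply: eq_bigr => c _; rewrite mulrA.
  have dge0 a b : 0 <= d a b by rewrite mulr_ge0 ?ler0n ?mulr_ge0 ?exprn_ge0.
  have tge0 a b c : 0 <= t a b c by rewrite !mulr_ge0 ?exprn_ge0.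
  (* If two indices coincide, one of the [e] terms already equals [t a b c]; otherwise AM-GM applies
     to the three pairwise products. *)
  have t_le a b c : t a b c <= 3^-1 * (d a b + d a c + d b c) +
      (e a b * t a b c + e a c * t a b c + e b c * t a b c).
    have [ba|ba] := eqVneq b a.
      rewrite /e ba eqxx mul1r ler_wpDl ?mulr_ge0 ?addr_ge0 ?invr_ge0 ?ler0n //.
      by rewrite -addrA lerDl addr_ge0 ?mulr_ge0 ?ler0n // -?ba.
    have [ca|ca] := eqVneq c a.
      rewrite /e ca eqxx mul1r ler_wpDl ?mulr_ge0 ?addr_ge0 ?invr_ge0 ?ler0n //.
      by rewrite -addrA addrCA lerDl addr_ge0 ?mulr_ge0 ?ler0n.
    have [cb|cb] := eqVneq c b.
      rewrite /e cb eqxx mul1r ler_wpDl ?mulr_ge0 ?addr_ge0 ?invr_ge0 ?ler0n //.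
      by rewrite lerDr addr_ge0 ?mulr_ge0 ?ler0n.
    rewrite /d ba ca cb /e (negbTE ba) (negbTE ca) (negbTE cb) !mul1r !mul0r !addr0.
    set x := v a * v b; set y := v a * v c; set z := v b * v c.
    have x0 : 0 <= x by rewrite mulr_ge0.
    have y0 : 0 <= y by rewrite mulr_ge0.
    have z0 : 0 <= z by rewrite mulr_ge0.
    have -> : t a b c = x * y * z by rewrite /t /x /y /z; ring.
    rewrite -!exprMn -/x -/y -/z.
    (* This product is twice [x ^+ 3 + y ^+ 3 + z ^+ 3 - 3 * x * y * z]. *)
    suff : 0 <= (x + y + z) * ((x - y) ^+ 2 + (x - z) ^+ 2 + (y - z) ^+ 2) by lra.
    by rewrite mulr_ge0 ?addr_ge0 ?sqr_ge0.
  have DE : D = \sum_a \sum_b d a b.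
    apply: eq_bigr => a _; rewrite big_mkcond; apply: eq_bigr => b _.
    by rewrite /d; case: (b != a); rewrite ?mul1r ?mul0r.
  have sum_cst (x : R) : \sum_(a : T) x = #|T|%:R * x.
    by rewrite sumr_const -[x *+ _]mulr_natl.
  have sum_e (a : T) (f : T -> R) : \sum_b e a b * f b = f a.
    rewrite (bigD1 a) //= /e eqxx mul1r big1 ?addr0 // => b /negbTE ->.
    by rewrite mul0r.
  have d12 : \sum_a \sum_b \sum_(c : T) d a b = #|T|%:R * D.
    rewrite DE mulr_sumr; apply: eq_bigr => a _; rewrite mulr_sumr.
    by apply: eq_bigr => b _; rewrite sum_cst.
  have d13 : \sum_a \sum_(b : T) \sum_c d a c = #|T|%:R * D.
    by rewrite DE mulr_sumr; apply: eq_bigr => a _; rewrite sum_cst.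
  have d23 : \sum_(a : T) \sum_b \sum_c d b c = #|T|%:R * D by rewrite sum_cst DE.
  have P12 : P1 * P2 = \sum_a \sum_b v a ^+ 2 * v b ^+ 4.
    by rewrite mulr_suml; apply: eq_bigr => a _; rewrite mulr_sumr.
  have e12 : \sum_a \sum_b \sum_c e a b * t a b c = P1 * P2.
    rewrite P12 exchange_big /= exchange_big /=.
    under eq_bigr do under eq_bigr do rewrite -mulr_sumr.
    under eq_bigr do rewrite sum_e.
    rewrite exchange_big; apply: eq_bigr => a _; apply: eq_bigr => b _.
    by rewrite /t; ring.
  have e13 : \sum_a \sum_b \sum_c e a c * t a b c = P1 * P2.
    rewrite P12 exchange_big; apply: eq_bigr => b _; apply: eq_bigr => a _.
    by rewrite sum_e /t; ring.
  have e23 : \sum_a \sum_b \sum_c e b c * t a b c = P1 * P2.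
    rewrite P12; apply: eq_bigr => a _; apply: eq_bigr => b _.
    by rewrite sum_e /t; ring.
  rewrite cubeE (le_trans (ler_sum _ (fun a _ => ler_sum _ (fun b _ =>
    ler_sum _ (fun c _ => t_le a b c))))) //.
  under eq_bigr do under eq_bigr do rewrite !big_split /= -mulr_sumr !big_split /=.
  under eq_bigr do rewrite !big_split /= -mulr_sumr !big_split /=.
  rewrite !big_split /= -mulr_sumr !big_split /= d12 d13 d23 e12 e13 e23.
  by lra.
(* In the first case [3 * P1 * P2] is at most half of [P1 ^+ 3]. In the second,
   [P1 ^+ 4 <= 36 * P2 ^+ 2 <= 36 * P1 * P3], and [P1] cancels. *)
have [P12|P12] := leP (6 * P2) (P1 ^+ 2).
  have : P1 * (6 * P2) <= P1 * P1 ^+ 2 by rewrite ler_wpM2l.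
  rewrite -exprS => h.
  by lra.
have [P1E|P1n0] := eqVneq P1 0.
  rewrite P1E expr0n /= addr_ge0 ?mulr_ge0 ?ler0n //.
  by do 2![apply: sumr_ge0 => ? _]; rewrite mulr_ge0 ?exprn_ge0.
have P1gt0 : 0 < P1 by rewrite lt0r P1n0.
rewrite ler_wpDl //.
  rewrite !mulr_ge0 ?ler0n //.
  by do 2![apply: sumr_ge0 => ? _]; rewrite mulr_ge0 ?exprn_ge0.
rewrite -(ler_pM2l P1gt0) -exprS.
have : (P1 ^+ 2) ^+ 2 <= (6 * P2) ^+ 2.
  by rewrite ler_sqr ?nnegrE ?exprn_ge0 ?mulr_ge0 ?ler0n ?(ltW P12).
rewrite -exprM exprMn => /le_trans; apply.
have -> : P1 * (36 * P3) = 6 ^+ 2 * (P1 * P3) by ring.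
by rewrite ler_wpM2l ?exprn_ge0 ?ler0n.
Qed.

(** Here [v ^+ 2] is the function being transformed, so [v ^+ 3] is its power 3/2. Apply
    [cube_sum_le] on each line and sum over all lines; the two resulting terms give 38 = 2 + 36. *)
Lemma xray_bound (R : realFieldType) (F : finFieldType) (v : F -> F -> R) :
  (forall a s, 0 <= v a s) ->
  \sum_b \sum_s (\sum_a v a (s - a * b) ^+ 2) ^+ 3 <=
    38 * #|F|%:R * (\sum_a \sum_s v a s ^+ 3) ^+ 2.
Proof.
move=> v0; set S := \sum_a \sum_s v a s ^+ 3.
have diag : \sum_b \sum_s \sum_a v a (s - a * b) ^+ 6 <= #|F|%:R * S ^+ 2.
  (* For each slope [b] the shear [(a, s) |-> (a, s - a * b)] permutes the plane, so every [b]
     contributes the same sum. *)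
  have -> : \sum_b \sum_s \sum_a v a (s - a * b) ^+ 6 =
      #|F|%:R * \sum_a \sum_s v a s ^+ 6.
    transitivity (\sum_(b : F) \sum_a \sum_s v a s ^+ 6); last first.
      by rewrite sumr_const -[_ *+ _]mulr_natl.
    apply: eq_bigr => b _; rewrite exchange_big; apply: eq_bigr => a _.
    by rewrite [RHS](reindex_inj (subIr (a * b))).
  rewrite ler_wpM2l ?ler0n // [S ^+ 2]expr2 {1}/S mulr_suml.
  apply: ler_sum => a _; rewrite mulr_suml; apply: ler_sum => s _.
  rewrite (exprD _ 3 3) ler_wpM2l ?exprn_ge0 // /S (bigD1 a) //= (bigD1 s) //=.
  rewrite -addrA lerDl addr_ge0 ?sumr_ge0 // => [? _|? _].
    by rewrite exprn_ge0.
  by apply: sumr_ge0 => ? _; rewrite exprn_ge0.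
have offdiag : \sum_b \sum_s \sum_a \sum_(a' | a' != a)
    v a (s - a * b) ^+ 3 * v a' (s - a' * b) ^+ 3 <= S ^+ 2.
  have -> : \sum_b \sum_s \sum_a \sum_(a' | a' != a)
      v a (s - a * b) ^+ 3 * v a' (s - a' * b) ^+ 3 =
    \sum_a \sum_(a' | a' != a) \sum_b \sum_s v a s ^+ 3 * v a' (s + (a - a') * b) ^+ 3.
    rewrite pair_big exchange_big; apply: eq_bigr => a _; rewrite exchange_big.
    apply: eq_bigr => a' _; rewrite -(pair_big xpredT xpredT
      (fun b s => v a (s - a * b) ^+ 3 * v a' (s - a' * b) ^+ 3)) /=.
    apply: eq_bigr => b _; rewrite (reindex_inj (addIr (a * b))) /=.
    apply: eq_bigr => s _; congr (v _ _ ^+ _ * v _ _ ^+ _); ring.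
  rewrite [S ^+ 2]expr2 {1}/S mulr_suml; apply: ler_sum => a _.
  apply: (@le_trans _ _ (\sum_a' \sum_s \sum_s' v a s ^+ 3 * v a' s' ^+ 3)).
    rewrite [X in _ <= X](bigID (fun a' => a' != a)) /= -[X in X <= _]addr0.
    rewrite lerD //; last by do 3![apply: sumr_ge0 => ? _]; rewrite mulr_ge0 ?exprn_ge0.
    apply: ler_sum => a' a'a; rewrite exchange_big; apply: ler_sum => s _.
    (* For [a' != a] the map [b |-> s + (a - a') * b] is a bijection: the second point determines
       the line. *)
    have a'a0 : a - a' != 0 by rewrite subr_eq0 eq_sym.
    rewrite [X in _ <= X](reindex_inj (addrI s)) /=.
    by rewrite [X in _ <= X](reindex_inj (mulfI a'a0)).
  rewrite mulr_suml exchange_big; apply: ler_sum => s _.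
  rewrite /S mulr_sumr; apply: ler_sum => a' _.
  by rewrite mulr_sumr.
apply: (@le_trans _ _ (\sum_b \sum_s (2 * #|F|%:R * (\sum_a \sum_(a' | a' != a)
    v a (s - a * b) ^+ 3 * v a' (s - a' * b) ^+ 3) +
    36 * \sum_a v a (s - a * b) ^+ 6))).
  by do 2![apply: ler_sum => ? _]; apply: cube_sum_le => ?; apply: v0.
under eq_bigr do rewrite big_split /= -!mulr_sumr.
rewrite big_split /= -!mulr_sumr.
have := ler_wpM2l (ler0n R #|F|) offdiag.
move: diag; set X := \sum_b _; set Y := \sum_b _ => hX hY.
by lra.
Qed.

Lemma powR_divK (R : realType) (x a b : R) :
  0 <= x -> a * b = 1 -> (x `^ a) `^ b = x.
Proof. by move=> x0 ab; rewrite -powRrM ab powRr1. Qed.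

(** After normalization both sides carry the same power of the field size, so the constant 38 does
    not depend on [F]. *)
Lemma xray_avg (R : realType) (F : finFieldType) (h : F -> F -> R) :
  (forall a s, 0 <= h a s) ->
  avg (fun b => avg (fun s => avg (fun a => h a (s - a * b)) ^+ 3)) <=
    38 * avg (fun a => avg (fun s => h a s `^ (3 / 2))) ^+ 2.
Proof.
move=> h0; pose v a s := h a s `^ 2^-1.
have q0 : (0 : R) < #|F|%:R by rewrite ltr0n; apply/card_gt0P; exists 0.
have v0 a s : 0 <= v a s by apply: powR_ge0.
have v2 a s : v a s ^+ 2 = h a s.
  by rewrite -powR_mulrn // powR_divK // mulVf ?pnatr_eq0.
have v3 a s : h a s `^ (3 / 2) = v a s ^+ 3.
  by rewrite -powR_mulrn // -powRrM [2^-1 * _]mulrC.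
have -> : avg (fun b => avg (fun s => avg (fun a => h a (s - a * b)) ^+ 3)) =
    #|F|%:R^-1 ^+ 5 * \sum_b \sum_s (\sum_a v a (s - a * b) ^+ 2) ^+ 3.
  rewrite [in RHS]mulr_sumr /avg mulr_sumr; apply: eq_bigr => b _.
  rewrite [in RHS]mulr_sumr mulr_sumr mulr_sumr; apply: eq_bigr => s _.
  by under [in RHS]eq_bigr do rewrite v2; rewrite exprMn; ring.
have -> : avg (fun a => avg (fun s => h a s `^ (3 / 2))) =
    #|F|%:R^-1 ^+ 2 * \sum_a \sum_s v a s ^+ 3.
  rewrite /avg -mulr_sumr mulrA -expr2; congr (_ * _).
  by do 2![apply: eq_bigr => ? _]; rewrite v3.
have -> : 38 * (#|F|%:R^-1 ^+ 2 * \sum_a \sum_s v a s ^+ 3) ^+ 2 =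
    #|F|%:R^-1 ^+ 5 * (38 * #|F|%:R * (\sum_a \sum_s v a s ^+ 3) ^+ 2).
  by field; rewrite gt_eqF.
by rewrite ler_wpM2l ?exprn_ge0 ?invr_ge0 ?ler0n ?xray_bound.
Qed.

(** Substituting s = t + ab/2 moves both half-shifts onto [h], so the left side pairs [g] with the
    X-ray transform of [h]. Hölder with exponents 3/2 and 3 and [xray_avg] finish. *)
Lemma heis1_bound (R : realType) (F : finFieldType) (g h : F -> F -> R) :
  (2 : F) != 0 -> (forall a s, 0 <= g a s) -> (forall a s, 0 <= h a s) ->
  avg (fun b => avg (fun a => avg (fun t =>
    g b (t + 2^-1 * a * b) * h a (t - 2^-1 * a * b)))) <=
  38 `^ 3^-1 * (avg (fun b => avg (fun s => g b s `^ (3 / 2))) `^ (2 / 3) *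
                avg (fun a => avg (fun s => h a s `^ (3 / 2))) `^ (2 / 3)).
Proof.
move=> two0 g0 h0; pose K b s := avg (fun a => h a (s - a * b)).
have K0 b s : 0 <= K b s by apply: avg_ge0 => a.
(* The Hölder family is indexed by [bool]: [true] stands for [g], [false] for the transform [K]. *)
have -> : avg (fun b => avg (fun a => avg (fun t =>
      g b (t + 2^-1 * a * b) * h a (t - 2^-1 * a * b)))) =
    avg (fun z => \prod_(j : bool)
      (if j then g z.1 z.2 `^ (3 / 2) else K z.1 z.2 ^+ 3) `^
      (if j then 2 / 3 else 3^-1)).
  rewrite avg_pair; apply: eq_avg => b.
  transitivity (avg (fun a => avg (fun s => g b s * h a (s - a * b)))).
    apply: eq_avg => a; rewrite -[RHS](reindex_avg _ (addIr (2^-1 * a * b))).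
    apply: eq_avg => t; congr (_ * h _ _); field; exact: two0.
  rewrite exchange_avg; apply: eq_avg => s.
  rewrite avgZ big_bool /= -powR_mulrn // powR_divK //; last by field.
  by rewrite powR_divK // divff ?pnatr_eq0.
apply: (le_trans (holder_avg _ _ _)).
- by case=> _; rewrite ?divr_gt0 ?invr_gt0 ?ltr0n.
- by case=> z _; rewrite ?powR_ge0 ?exprn_ge0.
- by rewrite big_bool /=; field.
set A := avg (fun a => avg (fun s => h a s `^ (3 / 2))).
have A0 : 0 <= A by do 2![apply: avg_ge0 => ?]; apply: powR_ge0.
rewrite big_bool /= mulrCA !avg_pair /= ler_wpM2l ?powR_ge0 //.
have -> : 38 `^ 3^-1 * A `^ (2 / 3) = (38 * A ^+ 2) `^ 3^-1.
  by rewrite powRM ?exprn_ge0 // -powR_mulrn // -powRrM.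
apply: ge0_ler_powR; rewrite ?nnegrE ?invr_ge0 ?ler0n //.
- by do 2![apply: avg_ge0 => ?]; rewrite exprn_ge0.
- by rewrite (mulr_ge0 _ (exprn_ge0 _ A0)) ?ler0n.
- exact: xray_avg.
Qed.

(** * Averages over single coordinates and Finner's inequality *)

Definition set_coord (F : Type) (m : nat) (i : 'I_m) (c : F) (x : 'rV[F]_m) :
    'rV[F]_m :=
  \row_j (if j == i then c else x 0 j).

Definition indep_of_coord (F S : Type) (m : nat) (i : 'I_m) (f : 'rV[F]_m -> S) :=
  forall c x, f (set_coord i c x) = f x.

(** The result is still a function on all of ['rV_m], so averages over several coordinates can be
    iterated without changing the dimension. *)
Definition avg_coord (R : realType) (F : finType) (m : nat) (i : 'I_m)
    (f : 'rV[F]_m -> R) (x : 'rV[F]_m) : R :=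
  avg (fun c => f (set_coord i c x)).

Lemma set_coordK (F : Type) (m : nat) (i : 'I_m) (c d : F) (x : 'rV[F]_m) :
  set_coord i c (set_coord i d x) = set_coord i c x.
Proof. by apply/rowP => j; rewrite !mxE; case: eqP. Qed.

Lemma set_coord_id (F : Type) (m : nat) (i : 'I_m) (x : 'rV[F]_m) :
  set_coord i (x 0 i) x = x.
Proof. by apply/rowP => j; rewrite !mxE; case: eqP => // ->. Qed.

Lemma set_coordE (F : Type) (m : nat) (i : 'I_m) (c : F) (x : 'rV[F]_m) :
  set_coord i c x 0 i = c.
Proof. by rewrite mxE eqxx. Qed.

Lemma set_coordC (F : Type) (m : nat) (i j : 'I_m) (c d : F) (x : 'rV[F]_m) :
  i != j -> set_coord i c (set_coord j d x) = set_coord j d (set_coord i c x).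
Proof.
move=> ij; apply/rowP => l; rewrite !mxE; case: (eqVneq l i) => // ->.
by rewrite (negbTE ij).
Qed.

(** Turn [x] into [y] by replacing one coordinate at a time. *)
Lemma indep_of_all_coords (F S : Type) (m : nat) (f : 'rV[F]_m -> S) :
  (forall i, indep_of_coord i f) -> forall x y, f x = f y.
Proof.
move=> ff x y; pose z s := foldr (fun i => set_coord i (y 0 i)) x s.
have fz s : f (z s) = f x by elim: s => //= i s IHs; rewrite ff.
rewrite -(fz (enum 'I_m)); congr f; apply/rowP => j.
have zE s : z s 0 j = if j \in s then y 0 j else x 0 j.
  elim: s => //= i s IHs; rewrite mxE in_cons.
  by have [->|] := eqVneq j i => //=.
by rewrite zE mem_enum.
Qed.

Section AvgCoord.
Variables (R : realType) (F : finType) (m : nat).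
Implicit Types (i j : 'I_m) (f : 'rV[F]_m -> R).

Lemma avg_coord_ge0 i f x : (forall y, 0 <= f y) -> 0 <= avg_coord i f x.
Proof. by move=> f0; apply: avg_ge0 => c; apply: f0. Qed.

Lemma ler_avg_coord i f g x :
  (forall y, f y <= g y) -> avg_coord i f x <= avg_coord i g x.
Proof. by move=> fg; apply: ler_avg => c; apply: fg. Qed.

Lemma indep_avg_coord i f : indep_of_coord i (avg_coord i f).
Proof. by move=> c x; apply: eq_avg => d; rewrite set_coordK. Qed.

Lemma indep_of_coord_avg i j f : indep_of_coord i f -> indep_of_coord i (avg_coord j f).
Proof.
have [-> _|ij fi c x] := eqVneq i j; first exact: indep_avg_coord.
by apply: eq_avg => d; rewrite set_coordC ?fi // eq_sym.
Qed.

(* [(x, c) |-> (set_coord i c x, x 0 i)] is an involution of ['rV_m * F]. *)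
Lemma avg_avg_coord (c0 : F) i f : avg (avg_coord i f) = avg f.
Proof.
pose h (z : 'rV[F]_m * F) := (set_coord i z.2 z.1, z.1 0 i).
have hI : injective h.
  apply: (can_inj (g := h)) => -[x c].
  by rewrite /h /= set_coordK set_coord_id set_coordE.
transitivity (avg (fun z : 'rV[F]_m * F => f (h z).1)).
  by rewrite avg_pair.
rewrite (reindex_avg (fun z => f z.1) hI) avg_pair; apply: eq_avg => x /=.
exact: avg_cst c0 _.
Qed.

End AvgCoord.

(* Finner's inequality, by averaging over one coordinate at a time: each such
   step is an instance of Hölder's inequality, because the functions that do
   not depend on the coordinate factor out. *)
Lemma finner (R : realType) (F : finType) (c0 : F) (m : nat) (J : finType)
    (P : 'I_m -> pred J) (p : J -> R) (G : J -> 'rV[F]_m -> R) :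
  (forall j, 0 < p j) -> (forall j x, 0 <= G j x) ->
  (forall i j, ~~ P i j -> indep_of_coord i (G j)) ->
  (forall i, P i =1 xpred0 \/ \sum_(j | P i j) p j = 1) ->
  avg (fun x => \prod_j G j x `^ p j) <= \prod_j avg (G j) `^ p j.
Proof.
move=> p0 G0 GP P1; pose A s (f : 'rV[F]_m -> R) := foldr (@avg_coord R F m) f s.
have A_ge0 s f x : (forall y, 0 <= f y) -> 0 <= A s f x.
  by move=> f0; elim: s x => //= i s IHs x; apply: avg_coord_ge0.
have A_free s i f : i \in s \/ indep_of_coord i f -> indep_of_coord i (A s f).
  elim: s => [[]//|j s IHs] /=; rewrite in_cons.
  have [-> _|ij] := eqVneq i j; first exact: indep_avg_coord.
  by move=> fi; apply: indep_of_coord_avg; apply: IHs.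
(* Averaged over every coordinate, a function is constant, and its value is the global average. *)
have A_avg f x : A (enum 'I_m) f x = avg f.
  have -> : avg f = avg (A (enum 'I_m) f).
    by elim: (enum 'I_m) => //= i s IHs; rewrite avg_avg_coord.
  rewrite -[LHS](avg_cst x); apply: eq_avg => y.
  by apply: indep_of_all_coords => i; apply: A_free; left; rewrite mem_enum.
(* Generalized to partial averages, so that induction over the list of coordinates applies. *)
suff le_A s x : A s (fun y => \prod_j G j y `^ p j) x <= \prod_j A s (G j) x `^ p j.
  have /= := le_A (enum 'I_m) (\row_i c0).
  by rewrite A_avg; under eq_bigr do rewrite A_avg.
elim: s x => //= i s IHs x; apply: (le_trans (ler_avg_coord _ _ IHs)).
rewrite (bigID (P i)) /= mulrC.
have GPs j c : ~~ P i j -> A s (G j) (set_coord i c x) = A s (G j) x.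
  by move=> Pij; apply: A_free; right; apply: GP.
pose L := \prod_(j | ~~ P i j) A s (G j) x `^ p j.
have -> : \prod_(j | ~~ P i j) avg_coord i (A s (G j)) x `^ p j = L.
  apply: eq_bigr => j Pij; congr (_ `^ _); rewrite -[RHS](avg_cst c0).
  by apply: eq_avg => c; apply: GPs.
have -> : avg_coord i (fun y => \prod_j A s (G j) y `^ p j) x =
    L * avg (fun c => \prod_(j | P i j) A s (G j) (set_coord i c x) `^ p j).
  rewrite -avgZ; apply: eq_avg => c; rewrite (bigID (P i)) /= mulrC.
  by congr (_ * _); apply: eq_bigr => j Pij; rewrite GPs.
rewrite ler_wpM2l ?prodr_ge0 // => [j _|]; first exact: powR_ge0.
(* If [P i] is empty, all factors have moved into [L] and the average of the empty product is 1. *)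
case: (P1 i) => [P0|sum1].
  rewrite big_pred0 // (eq_avg (g := fun=> 1)) ?(avg_cst c0) // => c.
  by rewrite big_pred0.
by apply: holder_avg => // j y _; apply: A_ge0.
Qed.

(** * Odd fields and the Heisenberg projections *)

(** Translating the sum of all elements by 1 shows that [#|F|] is zero in [F]; if also 2 = 0, an odd
    [#|F|] would equal 1 there. *)
Lemma finField_two_neq0 (F : finFieldType) : odd #|F| -> (2 : F) != 0.
Proof.
move=> oddF; apply/eqP => two0.
have : \sum_(x : F) x = \sum_(x : F) (x + 1) by rewrite [LHS](reindex_inj (addIr 1)).
rewrite big_split /= sumr_const -[LHS]addr0 => /addrI/eqP.
rewrite -(odd_double_half #|F|) oddF mulrnDr -muln2 mulnC mulrnA two0 mul0rn addr0.
by rewrite eq_sym oner_eq0.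
Qed.

Lemma drop_append_set (F : finFieldType) (m : nat) (j : 'I_m) (c s : F)
    (x : 'rV[F]_m) :
  drop_append j (set_coord j c x) s = drop_append j x s.
Proof.
congr (castmx _ (row_mx _ _)); apply/matrixP => a b.
by rewrite !mxE eq_sym (negbTE (neq_lift _ _)) (ord1 a).
Qed.

(** Recording the removed coordinate alongside makes the map a bijection of ['rV_m * F], hence
    measure preserving. *)
Lemma avg_drop_append (R : realType) (F : finFieldType) (m : nat) (j : 'I_m)
    (f : 'rV[F]_m -> R) :
  avg (fun x => avg (fun t => f (drop_append j x t))) = avg f.
Proof.
pose h (z : 'rV[F]_m * F) := (drop_append j z.1 z.2, z.1 0 j).
have hI : injective h.
  move=> [x s] [y t] [/(can_inj (castmxK _ _))/eq_row_mx[xy st] xyj].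
  have -> : s = t by have /matrixP/(_ 0 0) := st; rewrite !mxE.
  congr (_, _); apply/rowP => i; have [->//|ij] := eqVneq i j.
  by apply: (col'_eq xy); rewrite inE.
have := reindex_avg (fun z => f z.1) hI; rewrite !avg_pair /= => ->.
by apply: eq_avg => x; rewrite (avg_cst (0 : F)).
Qed.

(** The displacement of t under the projection, isolated because it depends on [x] alone. *)
Definition heis_shift (F : finFieldType) (n : nat) (j : 'I_(n + n))
    (x : 'rV[F]_(n + n)) : F :=
  match fintype.split j with
  | inl i => 2^-1 * x 0 (lshift n i) * x 0 (rshift n i)
  | inr i => - (2^-1 * x 0 (lshift n i) * x 0 (rshift n i))
  end.

Lemma heis_projE (F : finFieldType) (n : nat) (j : 'I_(n + n))
    (x : 'rV[F]_(n + n)) (t : F) :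
  heis_proj j (x, t) = drop_append j x (t + heis_shift j x).
Proof. by rewrite /heis_proj /heis_shift; case: fintype.split. Qed.

(** * Averages over t and the k-th coordinate pair *)

(** An average over a copy of the first Heisenberg group, with the other 2n - 2 coordinates
    frozen. *)
Definition heis_avg (R : realType) (F : finFieldType) (n : nat) (k : 'I_n)
    (f : 'rV[F]_(n + n) -> F -> R) : 'rV[F]_(n + n) -> R :=
  avg_coord (rshift n k) (avg_coord (lshift n k) (fun y => avg (f y))).

Lemma avg_heis_avg (R : realType) (F : finFieldType) (n : nat) (k : 'I_n)
    (f : 'rV[F]_(n + n) -> F -> R) :
  avg (heis_avg k f) = avg (fun x => avg (f x)).
Proof. by rewrite /heis_avg !(avg_avg_coord 0). Qed.

(** For fixed [y] the shift is a translation of t, which the innermost average absorbs. The shift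
    varies with [j], so this treats one projection at a time. *)
Lemma heis_avg_proj (R : realType) (F : finFieldType) (n : nat) (k : 'I_n)
    (j : 'I_(n + n)) (f : 'rV[F]_(n + n) -> R) (x : 'rV[F]_(n + n)) :
  heis_avg k (fun y t => f (heis_proj j (y, t))) x =
  heis_avg k (fun y t => f (drop_append j y t)) x.
Proof.
apply: eq_avg => b; apply: eq_avg => a; set y := set_coord _ _ _.
rewrite -[RHS](reindex_avg _ (addIr (heis_shift j y))).
by apply: eq_avg => t; rewrite heis_projE.
Qed.

Lemma lshift_neq_rshift (m n : nat) (i : 'I_m) (j : 'I_n) :
  lshift n i != rshift m j.
Proof.
by apply/eqP => /(congr1 val) /= e; have := ltn_ord i; rewrite e ltnNge leq_addr.
Qed.

Lemma prod_pair_shift (R : comPzRingType) (n : nat) (k : 'I_n) (H : 'I_(n + n) -> R) :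
  \prod_j H j = H (lshift n k) * H (rshift n k) *
    \prod_(j | (j != lshift n k) && (j != rshift n k)) H j.
Proof.
rewrite (bigD1 (lshift n k)) //= (bigD1 (rshift n k)) //= 1?mulrA //.
by rewrite eq_sym lshift_neq_rshift.
Qed.

Lemma prod_off_shift (R : comPzRingType) (n : nat) (k : 'I_n) (H : 'I_(n + n) -> R) :
  \prod_(j | (j != lshift n k) && (j != rshift n k)) H j =
  \prod_(j < n | j != k) (H (lshift n j) * H (rshift n j)).
Proof.
rewrite big_split_ord big_split /=; congr (_ * _); apply: eq_bigl => i.
  by rewrite lshift_neq_rshift andbT (inj_eq (@lshift_inj _ _)).
by rewrite eq_sym lshift_neq_rshift (inj_eq (@rshift_inj _ _)).
Qed.

Lemma sum_pair_shift (R : zmodType) (n : nat) (k : 'I_n) (H : 'I_(n + n) -> R) :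
  \sum_j H j = H (lshift n k) + (H (rshift n k) +
    \sum_(j | (j != lshift n k) && (j != rshift n k)) H j).
Proof.
rewrite (bigD1 (lshift n k)) //= (bigD1 (rshift n k)) //=.
by rewrite eq_sym lshift_neq_rshift.
Qed.

Lemma sum_off_shift (R : pzRingType) (n : nat) (k : 'I_n) (c : R) :
  \sum_(j : 'I_(n + n) | (j != lshift n k) && (j != rshift n k)) c =
  (n + n)%:R * c - c - c.
Proof.
have := sum_pair_shift k (fun=> c); rewrite sumr_const card_ord.
by rewrite -[c *+ _]mulr_natl => ->; rewrite [c + _]addrC addrK addrC addKr.
Qed.

Lemma heis_shift_set (F : finFieldType) (n : nat) (k : 'I_n) (a b : F)
    (x : 'rV[F]_(n + n)) :
  let y := set_coord (lshift n k) a (set_coord (rshift n k) b x) in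
  heis_shift (lshift n k) y = 2^-1 * a * b /\
  heis_shift (rshift n k) y = - (2^-1 * a * b).
Proof.
move=> y; have ya : y 0 (lshift n k) = a by apply: set_coordE.
have yb : y 0 (rshift n k) = b.
  by rewrite mxE eq_sym (negbTE (lshift_neq_rshift _ _)) set_coordE.
rewrite /heis_shift (unsplitK (inl k) : fintype.split (lshift n k) = _).
by rewrite (unsplitK (inr k) : fintype.split (rshift n k) = _) ya yb.
Qed.

Lemma heis_avg_indep (R : realType) (F : finFieldType) (n : nat) (k : 'I_n)
    (f : 'rV[F]_(n + n) -> F -> R) (i : 'I_(n + n)) :
  [\/ i = lshift n k, i = rshift n k | forall t, indep_of_coord i (f ^~ t)] ->
  indep_of_coord i (heis_avg k f).
Proof.
case=> [->|->|fi].
- exact/indep_of_coord_avg/indep_avg_coord.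
- exact: indep_avg_coord.
- by do 2!apply: indep_of_coord_avg; move=> c x; apply: eq_avg => t; apply: fi.
Qed.

(** The reciprocals of the exponents of the norms in the theorem, used as weights in Finner's
    inequality. *)
Definition heis_weight (R : realType) (n : nat) (k : 'I_n) (j : 'I_(n + n)) : R :=
  if (j == lshift n k) || (j == rshift n k) then 2 / (2 * n + 1)%:R
  else (2 * n + 1)%:R^-1.

Lemma heis_weight_lshift (R : realType) (n : nat) (k : 'I_n) :
  heis_weight R k (lshift n k) = 2 / (2 * n + 1)%:R.
Proof. by rewrite /heis_weight eqxx. Qed.

Lemma heis_weight_rshift (R : realType) (n : nat) (k : 'I_n) :
  heis_weight R k (rshift n k) = 2 / (2 * n + 1)%:R.
Proof. by rewrite /heis_weight eqxx orbT. Qed.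

Lemma heis_weight_off (R : realType) (n : nat) (k : 'I_n) (j : 'I_(n + n)) :
  (j != lshift n k) && (j != rshift n k) ->
  heis_weight R k j = (2 * n + 1)%:R^-1.
Proof. by rewrite /heis_weight -negb_or => /negbTE ->. Qed.

Lemma heis_weight_gt0 (R : realType) (n : nat) (k : 'I_n) (j : 'I_(n + n)) :
  0 < heis_weight R k j.
Proof.
by rewrite /heis_weight; case: ifP; rewrite ?divr_gt0 ?invr_gt0 ?ltr0n ?addn1.
Qed.

(** Finner's condition at a coordinate outside the pair. The total weight is (2n + 2)/(2n + 1), and
    the one function that misses [i] has weight 1/(2n + 1). *)
Lemma sum_heis_weight (R : realType) (n : nat) (k : 'I_n) (i : 'I_(n + n)) :
  (i != lshift n k) && (i != rshift n k) ->
  \sum_(j | j != i) heis_weight R k j = 1.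
Proof.
move=> off_i; have := sum_pair_shift k (heis_weight R k).
rewrite (bigD1 i) //= heis_weight_off // heis_weight_lshift heis_weight_rshift.
under [in RHS]eq_bigr do rewrite heis_weight_off //.
rewrite sum_off_shift => /(canRL (addKr _)) ->; rewrite natrD natrM natrD.
by field; rewrite -natrM natr1 pnatr_eq0.
Qed.

(** The k-th projection forgets [a] and the (n+k)-th forgets [b], so with the other coordinates
    frozen this is [heis1_bound] for [u] and [v]. *)
Lemma heis_avg_pair (R : realType) (F : finFieldType) (n : nat) (k : 'I_n)
    (f g : 'rV[F]_(n + n) -> R) (x : 'rV[F]_(n + n)) :
  (2 : F) != 0 -> (forall y, 0 <= f y) -> (forall y, 0 <= g y) ->
  heis_avg k (fun y t => f (heis_proj (lshift n k) (y, t)) *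
                         g (heis_proj (rshift n k) (y, t))) x <=
  38 `^ 3^-1 *
    (heis_avg k (fun y t => f (drop_append (lshift n k) y t) `^ (3 / 2)) x `^ (2 / 3) *
     heis_avg k (fun y t => g (drop_append (rshift n k) y t) `^ (3 / 2)) x `^ (2 / 3)).
Proof.
move=> two0 f0 g0.
pose u b s := f (drop_append (lshift n k) (set_coord (rshift n k) b x) s).
pose v a s := g (drop_append (rshift n k) (set_coord (lshift n k) a x) s).
pose y a b := set_coord (lshift n k) a (set_coord (rshift n k) b x).
have yl a b s : f (drop_append (lshift n k) (y a b) s) = u b s.
  by rewrite /y drop_append_set.
have yr a b s : g (drop_append (rshift n k) (y a b) s) = v a s.
  rewrite /y (set_coordC _ _ _ (lshift_neq_rshift k k)).
  by rewrite (drop_append_set (rshift n k)).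
have fE : heis_avg k (fun y t => f (drop_append (lshift n k) y t) `^ (3 / 2)) x =
    avg (fun b => avg (fun s => u b s `^ (3 / 2))).
  apply: eq_avg => b; rewrite -[RHS](avg_cst (0 : F)); apply: eq_avg => a.
  by apply: eq_avg => t; rewrite -(yl a).
have gE : heis_avg k (fun y t => g (drop_append (rshift n k) y t) `^ (3 / 2)) x =
    avg (fun a => avg (fun s => v a s `^ (3 / 2))).
  rewrite -[RHS](avg_cst (0 : F)); apply: eq_avg => b; apply: eq_avg => a.
  by apply: eq_avg => t; rewrite -(yr a b).
have fgE : heis_avg k (fun y t => f (heis_proj (lshift n k) (y, t)) *
                                  g (heis_proj (rshift n k) (y, t))) x =
    avg (fun b => avg (fun a => avg (fun t =>
      u b (t + 2^-1 * a * b) * v a (t - 2^-1 * a * b)))).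
  apply: eq_avg => b; apply: eq_avg => a; apply: eq_avg => t.
  rewrite -(yl a) -(yr a b) !heis_projE.
  by have [-> ->] := heis_shift_set k a b x.
by rewrite fE gE fgE; apply: heis1_bound => // *; [apply: f0 | apply: g0].
Qed.

(* For fixed values of the other coordinates, Hölder's inequality separates the
   pair [f_k, f_(n+k)] from the other functions; the pair is then controlled by
   the inequality on the first Heisenberg group. *)
Lemma heis_avg_prod (R : realType) (F : finFieldType) (n : nat) (k : 'I_n)
    (f : 'I_(n + n) -> 'rV[F]_(n + n) -> R) (x : 'rV[F]_(n + n)) :
  (2 : F) != 0 -> (forall j y, 0 <= f j y) ->
  heis_avg k (fun y t => \prod_j f j (heis_proj j (y, t))) x <=
  (38 `^ 3^-1) `^ (3 / (2 * n + 1)%:R) *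
  \prod_j heis_avg k (fun y t =>
      f j (drop_append j y t) `^ (heis_weight R k j)^-1) x `^ heis_weight R k j.
Proof.
move=> two0 f0; set N : R := (2 * n + 1)%:R.
have N0 : N != 0 by rewrite pnatr_eq0 addn1.
have Npos : 0 < N by rewrite ltr0n addn1.
set l := lshift n k; set r := rshift n k.
pose G j := heis_avg k (fun y t =>
  f j (drop_append j y t) `^ (heis_weight R k j)^-1) x.
pose Y (z : F * F * F) := set_coord l z.1.2 (set_coord r z.1.1 x).
pose Psi j z := f j (heis_proj j (Y z, z.2)).
have heis_avgE (phi : 'rV[F]_(n + n) -> F -> R) :
    heis_avg k phi x = avg (fun z => phi (Y z) z.2).
  by rewrite !avg_pair.
(* The pair is merged into one function at index [l], so [r] leaves the index set. The weights are
   3/N for the pair and 1/N for each of the other 2n - 2 = N - 3 functions. *)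
pose W j z := if j == l then (Psi l z * Psi r z) `^ (N / 3) else Psi j z `^ N.
pose w j := if j == l then 3 / N else N^-1.
have prodE (H : 'I_(n + n) -> R) : \prod_(j | j != r) H j =
    H l * \prod_(j | (j != l) && (j != r)) H j.
  rewrite (bigD1 l) ?lshift_neq_rshift //=; congr (_ * _).
  by apply: eq_bigl => j; rewrite andbC.
have lE : (l == l) = true by rewrite eqxx.
have Psi0 j z : 0 <= Psi j z by apply: f0.
rewrite heis_avgE (eq_avg (g := fun z => \prod_(j | j != r) W j z `^ w j)); last first.
  move=> z; rewrite (prod_pair_shift k) prodE /W /w lE.
  rewrite powR_divK ?mulr_ge0 //; last by field.
  congr (_ * _); apply: eq_bigr => j /andP[/negbTE -> _].
  by rewrite powR_divK ?divff.
apply: (le_trans (holder_avg _ _ _)).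
- by move=> j _; rewrite /w; case: ifP; rewrite ?divr_gt0 ?invr_gt0 ?Npos ?ltr0n.
- by move=> j z _; rewrite /W; case: ifP; rewrite ?powR_ge0.
- rewrite (bigD1 l) ?lshift_neq_rshift //= {1}/w lE.
  under eq_bigl do rewrite andbC.
  rewrite (eq_bigr (fun=> N^-1)) ?sum_off_shift => [|j /andP[/negbTE jl _]].
    have -> : (n + n)%:R = N - 1 by rewrite /N mul2n -addnn [in RHS]natrD addrK.
    by field.
  by rewrite /w jl.
rewrite (_ : \prod_j heis_avg _ _ _ `^ _ = \prod_j G j `^ heis_weight R k j) //.
rewrite prodE (prod_pair_shift k) mulrA.
(* Each remaining function now stands alone under its average, so its shift can be removed. *)
rewrite (eq_bigr (fun j => G j `^ heis_weight R k j)); last first.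
  move=> j off_j; rewrite /w /W; case/andP: (off_j) => /negbTE -> _.
  rewrite /G heis_weight_off // invrK.
  by rewrite -(heis_avg_proj k j (fun y => f j y `^ N)) heis_avgE.
rewrite ler_wpM2r ?prodr_ge0 // => [j _|]; first exact: powR_ge0.
rewrite heis_weight_lshift heis_weight_rshift -/N /w lE.
have expE y : 0 <= y -> (y `^ (N / 3)) `^ (3 / 2) = y `^ (2 / N)^-1 :> R.
  by move=> y0; rewrite -powRrM; congr (_ `^ _); field.
have GE j : heis_weight R k j = 2 / N ->
    heis_avg k (fun y t => (f j (drop_append j y t) `^ (N / 3)) `^ (3 / 2)) x = G j.
  move=> jE; do 3!apply: eq_avg => ?.
  by rewrite expE ?jE.
have le_W : avg (W l) <= 38 `^ 3^-1 * (G l `^ (2 / 3) * G r `^ (2 / 3)).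
  rewrite -(GE l (heis_weight_lshift _ _)) -(GE r (heis_weight_rshift _ _)).
  apply: le_trans (@heis_avg_pair _ _ _ k (fun y => f l y `^ (N / 3))
    (fun y => f r y `^ (N / 3)) x two0 (fun y => powR_ge0 _ _)
    (fun y => powR_ge0 _ _)).
  rewrite heis_avgE /W lE; apply: ler_avg => z.
  by rewrite powRM.
have W0 : 0 <= avg (W l) by apply: avg_ge0 => z; rewrite /W lE powR_ge0.
have Gl0 : 0 <= G l by do 3!apply: avg_ge0 => ?; apply: powR_ge0.
have Gr0 : 0 <= G r by do 3!apply: avg_ge0 => ?; apply: powR_ge0.
move: (avg (W l)) (G l) (G r) W0 Gl0 Gr0 le_W => w0 A B W0 A0 B0 le_W.
(* Raising the bound for the pair to the Hölder weight 3/N turns the exponents 2/3 into the required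
   2/N. *)
have -> : (38 `^ 3^-1) `^ (3 / N) * (A `^ (2 / N) * B `^ (2 / N)) =
    (38 `^ 3^-1 * (A `^ (2 / 3) * B `^ (2 / 3))) `^ (3 / N).
  rewrite !powRM ?mulr_ge0 ?powR_ge0 // -!powRrM.
  by have -> : 2 / 3 * (3 / N) = 2 / N by field.
by rewrite ge0_ler_powR ?nnegrE ?divr_ge0 ?ler0n ?mulr_ge0 ?powR_ge0.
Qed.

(** * Norms as averages, and the conclusion *)

Lemma Lr_normE (R : realType) (F : finFieldType) (m : nat) (r : R)
    (f : 'rV[F]_m -> R) :
  (forall x, 0 <= f x) -> Lr_norm r f = avg (fun x => f x `^ r) `^ r^-1.
Proof.
move=> f0; rewrite /Lr_norm /avg card_mx mul1n natrX.
by under eq_bigr do rewrite ger0_norm //.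
Qed.

Theorem theorem4p1 (R : realType) (n : nat) (hn : (1 <= n)%N) (k : 'I_n) :
  exists2 C : R, 0 < C &
    forall (F : finFieldType) (hF : odd #|F|)
      (f : 'I_(n + n) -> 'rV[F]_(n + n) -> R)
      (hf : forall j x, 0 <= f j x),
    (#|F|%:R ^+ (2 * n + 1))^-1 *
      (\sum_(p : 'rV[F]_(n + n) * F) \prod_(j < n + n) f j (heis_proj j p))
    <= C * Lr_norm ((2 * n + 1)%:R / 2) (f (lshift n k))
         * Lr_norm ((2 * n + 1)%:R / 2) (f (rshift n k))
         * \prod_(j < n | j != k)
             (Lr_norm (2 * n + 1)%:R (f (lshift n j)) *
              Lr_norm (2 * n + 1)%:R (f (rshift n j))).
Proof.
exists ((38 `^ 3^-1) `^ (3 / (2 * n + 1)%:R)); first by rewrite !powR_gt0 ?ltr0n.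
move=> F /finField_two_neq0 two0 f f0.
pose p := heis_weight R k.
pose G j := heis_avg k (fun y t => f j (drop_append j y t) `^ (p j)^-1).
(* Inserting [heis_avg] leaves the total average unchanged and lets the bound of [heis_avg_prod] be
   applied at each point. *)
have -> : (#|F|%:R ^+ (2 * n + 1))^-1 *
    (\sum_z \prod_(j < n + n) f j (heis_proj j z)) =
    avg (heis_avg k (fun y t => \prod_j f j (heis_proj j (y, t)))).
  rewrite avg_heis_avg -(avg_pair (fun z => \prod_j f j (heis_proj j z))) /avg.
  congr (_^-1 * _).
  by rewrite card_prod card_mx mul1n -expnSr -natrX addnn -mul2n addn1.
apply: (le_trans (ler_avg (fun x => heis_avg_prod k x two0 f0))).
rewrite avgZ -!mulrA ler_wpM2l ?powR_ge0 //.
(* The functions [G j] have lost both coordinates of the pair, so [P i] is empty there; at any other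
   [i] only [G i] is independent of the coordinate. *)
pose P i (j : 'I_(n + n)) := [&& i != lshift n k, i != rshift n k & j != i].
apply: (le_trans (@finner _ _ 0 _ _ P p G _ _ _ _)).
- by move=> j; apply: heis_weight_gt0.
- by move=> j x; do 3!apply: avg_ge0 => ?; apply: powR_ge0.
- move=> i j; rewrite /P => hP; apply: heis_avg_indep.
  move: hP; have [->|_] := eqVneq i (lshift n k); first by constructor 1.
  have [->|_] := eqVneq i (rshift n k); first by constructor 2.
  rewrite /= negbK => /eqP ->; constructor 3 => t c x.
  by rewrite drop_append_set.
- move=> i; have [off_i|on_i] := boolP ((i != lshift n k) && (i != rshift n k)).
    right; rewrite -[RHS](sum_heis_weight R off_i); apply: eq_bigl => j.
    by rewrite /P andbA off_i.
  by left => j; rewrite /P andbA (negbTE on_i).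
have normE j : avg (G j) `^ p j = Lr_norm (p j)^-1 (f j).
  rewrite avg_heis_avg (avg_drop_append j (fun y => f j y `^ (p j)^-1)).
  by rewrite Lr_normE ?invrK.
under eq_bigr do rewrite normE.
have offE : \prod_(j | (j != lshift n k) && (j != rshift n k)) Lr_norm (p j)^-1 (f j) =
    \prod_(j | (j != lshift n k) && (j != rshift n k)) Lr_norm (2 * n + 1)%:R (f j).
  apply: eq_bigr => j off_j; congr (Lr_norm _ _).
  by rewrite /p (heis_weight_off R off_j) invrK.
rewrite (prod_pair_shift k) offE prod_off_shift /p heis_weight_lshift.
by rewrite heis_weight_rshift invf_div -mulrA.
Qed.
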